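(* Let $\mu\in\mathcal{P}(\mathcal{X})$ and let $K:\mathcal{X}\times\mathcal{X}\to(0,1]$ be measurable. Assume \[ \lim_{r\to\infty}\frac{\mu(\mathcal{X}\setminus B_r)}{\inf_{x,y\in B_r}K^2(x,y)}=0 . \] Then there exist real numbers $0<m_1\le m_2<\infty$, tail functions $\alpha,\tilde\alpha$ (with $\mu(B_{m_1})>0$ and $\alpha(r)>0$ for all $r>0$), and $\kappa\in(0,1)$ such that, writing $C=\mathcal{G}^{\mu}_{\alpha,\tilde\alpha}$ (built with these $m_1,m_2$), \[ d_{C}(L_{K,\mu}g,L_{K,\mu}\tilde g)\le\kappa\, d_{C}(g,\tilde g)\quad\text{for all } g,\tilde g\in C . \]
   Context: $\mathcal{X}$ is a Polish space with metric $d_{\mathcal{X}}$, $x_0\in\mathcal{X}$ is fixed, $B_r=\{x\in\mathcal{X}: d_{\mathcal{X}}(x_0,x)\le r\}$ and $B_r^{\mathsf c}=\mathcal{X}\setminus B_r$; $\mathcal{P}(\mathcal{X})$ denotes the Borel probability measures. For measurable $K$ with values in $(0,1]$, $L_{K,\mu}g(x)=\int K(x,y)g(y)\,\mu(dy)$. A tail function is a non-increasing $\alpha:(0,\infty)\to[0,\infty)$ with $\lim_{r\to\infty}\alpha(r)=0$. For $0<m_1\le m_2$ and tail functions $\alpha,\tilde\alpha$, let $\mathcal{F}^{\mu}_{\alpha,\tilde\alpha}$ be the set of $f\in L^2(\mu)$ with $f\mathbf 1_{B_{m_2}}\ge0$ $\mu$-a.s., $\int_{B_r^{\mathsf c}}f_+\,d\mu\le\alpha(r)\int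 f\,d\mu$ for all $r\ge m_1$, and $\int_{B_r^{\mathsf c}}f_-\,d\mu\le\tilde\alpha(r)\int f\,d\mu$ for all $r\ge m_2$ (where $f_+=\max\{f,0\}$, $f_-=-\min\{f,0\}$), and let $\mathcal{G}^{\mu}_{\alpha,\tilde\alpha}=\{g\in L^2(\mu):\int fg\,d\mu\ge0\text{ for all }f\in\mathcal{F}^{\mu}_{\alpha,\tilde\alpha}\}$, a cone in $L^2(\mu)$. Hilbert's metric for a cone $C$ (closed, convex, $\lambda C\subseteq C$ for $\lambda>0$, $C\cap-C=\{0\}$) in a Banach space: write $f\le_C g$ if $g-f\in C$; for $f,g\in C$, $f\sim_C g$ if $f\le_C bg$ and $g\le_C b'f$ for some $b,b'>0$; then $M(f,g)=\inf\{b>0:bg-f\in C\}$, $m(f,g)=\sup\{a>0:f-ag\in C\}$, and $d_C(f,g)=\log(M(f,g)/m(f,g))$ if $f\sim_C g$ and $g\ne0$, and $d_C(f,g)=\infty$ otherwise. *)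

(* Defs.v *)
From HB Require Import structures.
From mathcomp Require Import all_boot all_order all_algebra.
From mathcomp Require Import all_classical all_reals all_analysis.
Set Implicit Arguments. Unset Strict Implicit. Unset Printing Implicit Defensive.
Import Order.TTheory GRing.Theory Num.Theory.
Import numFieldNormedType.Exports.
Local Open Scope classical_set_scope.
Local Open Scope ring_scope.

Section Defs.
Context {R : realType} {dsp : measure_display} {T : measurableType dsp}.

Definition is_metric (dist : T -> T -> R) : Prop :=
  (forall x y, 0 <= dist x y) /\
  (forall x y, dist x y = 0 <-> x = y) /\
  (forall x y, dist x y = dist y x) /\
  (forall x y z, dist x z <= dist x y + dist y z).

Definition metric_complete (dist : T -> T -> R) : Prop :=
  forall u : nat -> T,
    (forall e : R, 0 < e -> exists N : nat, forall n m : nat,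
        (N <= n)%N -> (N <= m)%N -> dist (u n) (u m) < e) ->
    exists l : T, (fun n => dist (u n) l) @ \oo --> (0 : R).

Definition metric_separable (dist : T -> T -> R) : Prop :=
  exists D : nat -> T, forall (x : T) (e : R), 0 < e -> exists n, dist x (D n) < e.

Definition metric_open (dist : T -> T -> R) (A : set T) : Prop :=
  forall x, A x -> exists2 e : R, 0 < e & forall y, dist x y < e -> A y.

Definition polish_borel (dist : T -> T -> R) : Prop :=
  [/\ is_metric dist, metric_complete dist, metric_separable dist &
      (@measurable _ T) = <<s [set A | metric_open dist A] >> ].

Definition ball_c (dist : T -> T -> R) (x0 : T) (r : R) : set T :=
  [set x | dist x0 x <= r].

Definition L2 (mu : {measure set T -> \bar R}) (f : T -> R) : Prop :=
  measurable_fun setT f /\ (\int[mu]_x ((f x) ^+ 2)%:E < +oo)%E.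

Definition tail_function (alpha : R -> R) : Prop :=
  [/\ (forall r s, 0 < r -> r <= s -> alpha s <= alpha r),
      (forall r, 0 < r -> 0 <= alpha r) &
      alpha r @[r --> +oo] --> (0 : R)].

Definition fpos (f : T -> R) : T -> R := fun x => Num.max (f x) 0.
Definition fneg (f : T -> R) : T -> R := fun x => - Num.min (f x) 0.

Definition Fset (mu : {measure set T -> \bar R}) (dist : T -> T -> R) (x0 : T)
    (m1 m2 : R) (alpha alpha' : R -> R) : set (T -> R) :=
  [set f | [/\ L2 mu f,
     {ae mu, forall x, ball_c dist x0 m2 x -> 0 <= f x},
     (forall r, m1 <= r ->
        (\int[mu]_(x in ~` ball_c dist x0 r) (fpos f x)%:E
          <= (alpha r)%:E * \int[mu]_x (f x)%:E)%E) &
     (forall r, m2 <= r ->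
        (\int[mu]_(x in ~` ball_c dist x0 r) (fneg f x)%:E
          <= (alpha' r)%:E * \int[mu]_x (f x)%:E)%E) ] ].

Definition Gcone (mu : {measure set T -> \bar R}) (dist : T -> T -> R) (x0 : T)
    (m1 m2 : R) (alpha alpha' : R -> R) : set (T -> R) :=
  [set g | L2 mu g /\
     forall f, Fset mu dist x0 m1 m2 alpha alpha' f ->
       (0 <= \int[mu]_x (f x * g x)%:E)%E ].

Definition Lop (mu : {measure set T -> \bar R}) (K : T -> T -> R) (g : T -> R) : T -> R :=
  fun x => fine (\int[mu]_y (K x y * g y)%:E).

(* is_zero tells which elements are the zero vector of the ambient space
   (for L^2(mu): the mu-a.e. null functions) *)
Definition cone_le (C : set (T -> R)) (f g : T -> R) : Prop := C (g \- f).

Definition cone_comparable (C : set (T -> R)) (f g : T -> R) : Prop :=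
  exists b b' : R, [/\ 0 < b, 0 < b',
     cone_le C f (fun x => b * g x) & cone_le C g (fun x => b' * f x)].

Definition hilbert_M (C : set (T -> R)) (f g : T -> R) : R :=
  inf [set b : R | 0 < b /\ C (fun x => b * g x - f x)].

Definition hilbert_m (C : set (T -> R)) (f g : T -> R) : R :=
  sup [set a : R | 0 < a /\ C (fun x => f x - a * g x)].

Definition hilbert_dist (C : set (T -> R)) (is_zero : (T -> R) -> Prop)
    (f g : T -> R) : \bar R :=
  if `[< cone_comparable C f g /\ ~ is_zero g >]
  then (ln (hilbert_M C f g / hilbert_m C f g))%:E
  else +oo%E.

Definition ae_zero (mu : {measure set T -> \bar R}) : (T -> R) -> Prop :=
  fun g => {ae mu, forall x, g x = 0}.

End Defs.

(* Main.v *)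
Require Import Defs.
From HB Require Import structures.
From mathcomp Require Import all_boot all_order all_algebra.
From mathcomp Require Import all_classical all_reals all_analysis.
From mathcomp Require Import measurable_realfun ring lra.
Import Order.TTheory GRing.Theory Num.Theory.
Import numFieldNormedType.Exports.
Local Open Scope classical_set_scope.
Local Open Scope ring_scope.

(* Take m1 = m2 = m and write s(r) for the mass outside B_r, J for the infimum of
   K^2 on B_m x B_m. For f in the cone F with integral a, the image h of f under
   the adjoint operator is at least 3 J a / 8 on B_m, is bounded by 9 a / 8, and
   is nowhere below - J a / 8, because the negative part of f has mass at most
   2 s(m) a, which is small against J a once s(m) <= J / 64. Hence both
   h - (J / 8) a and 4 a - h lie in F again: the adjoint squeezes F between two
   multiples of the constant function, and dually every image L g, g in G, is
   comparable to one functional with uniform constants. The Birkhoff contraction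
   principle then applies. *)

(** * An elementary logarithmic inequality *)

(** Two regimes for r = [M / m]. If r is at least l^-4, the bound l^-2 on [x] already halves the
    logarithm. Otherwise the second bound gives ln x <= ln r - l (r - 1) / r, and the loss is at
    least l^5 ln r because ln r <= r - 1 and 1 / r >= l^4. *)
Lemma ln_contract (R : realType) (l m M x : R) :
  0 < l -> l <= 2^-1 -> 0 < m -> m <= M -> x <= l ^- 2 ->
  x <= 1 + (1 - l) * ((M - m) / m) ->
  ln x <= (1 - l ^+ 5) * ln (M / m).
Proof.
move=> l0 l2 m0 mM xl xM.
set r := M / m.
have r1 : 1 <= r by rewrite ler_pdivlMr// mul1r.
have r0 : 0 < r by lra.
have xr : x <= 1 + (1 - l) * (r - 1).
  have -> : r - 1 = (M - m) / m by rewrite /r; field; rewrite gt_eqF.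
  exact: xM.
have lnr0 : 0 <= ln r by exact: ln_ge0.
have l5 : l ^+ 5 <= 2^-1.
  have l1 : l <= 1 by lra.
  by rewrite (le_trans _ l2)// exprS ler_piMr ?exprn_ile1//; exact: ltW.
have k0 : 0 <= 1 - l ^+ 5 by lra.
(* [ln] takes the default value 0 on nonpositive arguments. *)
have [x0|x0] := leP x 0; first by rewrite ln0// mulr_ge0.
have l4 : 0 < l ^+ 4 by exact: exprn_gt0.
have [rl|lr] := leP (l ^- 4) r.
  have lnx : ln x <= 2^-1 * ln r.
    have -> : ln r = ln (l ^- 4) + (ln r - ln (l ^- 4)) by lra.
    have : ln (l ^- 4) <= ln r.
      by rewrite ler_ln ?posrE// invr_gt0.
    have : ln x <= ln (l ^- 2).
      by rewrite ler_ln ?posrE// invr_gt0 exprn_gt0.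
    have -> : l ^- 4 = (l ^- 2) ^+ 2 by rewrite -exprVn -exprVn -exprM.
    rewrite lnXn ?invr_gt0 ?exprn_gt0// mulr2n; lra.
  apply: (le_trans lnx); apply: ler_wpM2r => //; lra.
have t0 : 0 <= (r - 1) / r by apply: divr_ge0; lra.
have t1 : (r - 1) / r < 1 by rewrite ltr_pdivrMr// mul1r; lra.
have lt1 : l * ((r - 1) / r) < 1 by nra.
have xr' : x <= r * (1 - l * ((r - 1) / r)).
  have -> : r * (1 - l * ((r - 1) / r)) = r - l * (r - 1) by field; rewrite gt_eqF.
  lra.
have lnx : ln x <= ln r - l * ((r - 1) / r).
  apply: (@le_trans _ _ (ln (r * (1 - l * ((r - 1) / r))))).
    rewrite ler_ln ?posrE// mulr_gt0//; lra.
  rewrite lnM ?posrE//; last lra.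
  rewrite lerD2l.
  apply: le_ln1Dx; lra.
apply: (le_trans lnx).
suff : l ^+ 5 * ln r <= l * ((r - 1) / r) by lra.
rewrite exprS -mulrA; apply: ler_wpM2l; first exact: ltW.
have lnr : ln r <= r - 1.
  have {1}-> : r = 1 + (r - 1) by lra.
  by apply: le_ln1Dx; lra.
have l4r : l ^+ 4 <= r^-1.
  by rewrite -[leLHS]invrK lef_pV2 ?posrE ?invr_gt0// ltW.
rewrite mulrC; apply: ler_pM => //; exact: ltW.
Qed.

(** * Birkhoff contraction on a cone cut out by linear functionals *)

Section birkhoff.
Context {R : realType} {dsp : measure_display} {T : measurableType dsp}.
Variables (V F : set (T -> R)) (P : (T -> R) -> (T -> R) -> R).
Variables (L : (T -> R) -> (T -> R)) (e : T -> R) (is_zero : (T -> R) -> Prop).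
Variables (c C : R).

(** Abstract form of [Gcone]: [V] is the ambient space, [F] the set of test functions, [P] the
    pairing. Order relations in this cone are checked one functional at a time. *)
Definition dual_cone : set (T -> R) :=
  [set g | V g /\ forall f, F f -> 0 <= P f g].

Hypothesis V_lin : forall a b g g', V g -> V g' ->
  V (fun x => a * g x + b * g' x).
Hypothesis P_lin : forall f a b g g', F f -> V g -> V g' ->
  P f (fun x => a * g x + b * g' x) = a * P f g + b * P f g'.
Hypothesis L_V : forall g, V g -> V (L g).
Hypothesis L_lin : forall a b g g', V g -> V g' ->
  L (fun x => a * g x + b * g' x) = (fun x => a * L g x + b * L g' x).
Hypothesis e_F : F e.
Hypothesis P_zero : forall g, V g -> is_zero g -> P e g = 0.
Hypothesis cone_pos : forall g, dual_cone g -> ~ is_zero g -> 0 < P e g.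
Hypothesis c_gt0 : 0 < c.
Hypothesis cC : 2 * c <= C.
(** On the dual cone all functionals [P f (L _)] are comparable to the single functional [P e]. The
    ratio [C / c] is uniform; only the scale [a] depends on [f]. *)
Hypothesis L_bounds : forall f, F f -> exists2 a : R, 0 <= a &
  forall g, dual_cone g ->
    c * a * P e g <= P f (L g) /\ P f (L g) <= C * a * P e g.
Hypothesis L_bound_e : forall g, dual_cone g -> c * P e g <= P e (L g).

Let dual_coneB a b g g' : V g -> V g' ->
  dual_cone (fun x => a * g x - b * g' x) <->
  forall f, F f -> b * P f g' <= a * P f g.
Proof.
move=> Vg Vg'.
have -> : (fun x => a * g x - b * g' x) = (fun x => a * g x + (- b) * g' x).
  by apply/funext => x; rewrite mulNr.
split.
- by move=> [_ h] f Ff; have := h _ Ff; rewrite P_lin// mulNr subr_ge0.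
- move=> h; split; first exact: V_lin.
  by move=> f Ff; rewrite P_lin// mulNr subr_ge0; exact: h.
Qed.

Let dual_coneBl b g g' : V g -> V g' ->
  dual_cone (fun x => b * g' x - g x) <->
  forall f, F f -> P f g <= b * P f g'.
Proof.
move=> Vg Vg'.
have -> : (fun x => b * g' x - g x) = (fun x => b * g' x - 1 * g x).
  by apply/funext => x; rewrite mul1r.
by rewrite dual_coneB//; split => h f /h; rewrite mul1r.
Qed.

Let dual_coneBr a g g' : V g -> V g' ->
  dual_cone (fun x => g x - a * g' x) <->
  forall f, F f -> a * P f g' <= P f g.
Proof.
move=> Vg Vg'.
have -> : (fun x => g x - a * g' x) = (fun x => 1 * g x - a * g' x).
  by apply/funext => x; rewrite mul1r.
by rewrite dual_coneB//; split => h f /h; rewrite mul1r.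
Qed.

Let M_le b g g' : 0 < b -> dual_cone (fun x => b * g' x - g x) ->
  hilbert_M dual_cone g g' <= b.
Proof. by move=> b0 h; apply: inf_lbound => //; exists 0 => y [/ltW]. Qed.

(** Testing against [e] bounds the admissible values by [P e g / P e g'], so the supremum is a
    genuine one. *)
Let m_ge a g g' : V g -> V g' -> 0 < P e g' -> 0 < a ->
  dual_cone (fun x => g x - a * g' x) -> a <= hilbert_m dual_cone g g'.
Proof.
move=> Vg Vg' I0 a0 h; apply: ub_le_sup => //.
exists (P e g / P e g') => y [y0 /(dual_coneBr _ _ _ Vg Vg') /(_ _ e_F)].
by rewrite ler_pdivlMr.
Qed.

(** Each constraint P f g <= b P f g' is closed in b, hence survives the infimum. When [P f g']
    vanishes it does not involve b, and any admissible b establishes it. *)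
Let M_attained g g' : V g -> V g' ->
  [set b : R | 0 < b /\ dual_cone (fun x => b * g' x - g x)] !=set0 ->
  (forall f, F f -> 0 <= P f g') ->
  dual_cone (fun x => hilbert_M dual_cone g g' * g' x - g x).
Proof.
move=> Vg Vg' A0 Pg'; apply/(dual_coneBl _ _ _ Vg Vg') => f Ff.
have := Pg' _ Ff; rewrite le_eqVlt => /predU1P[P0|P0].
  have [b [_ /(dual_coneBl _ _ _ Vg Vg')/(_ _ Ff)]] := A0.
  by rewrite -P0 !mulr0.
rewrite -ler_pdivrMr//; apply: lb_le_inf => // b [_].
by move=> /(dual_coneBl _ _ _ Vg Vg')/(_ _ Ff); rewrite ler_pdivrMr.
Qed.

Let m_attained g g' : V g -> V g' ->
  [set a : R | 0 < a /\ dual_cone (fun x => g x - a * g' x)] !=set0 ->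
  (forall f, F f -> 0 <= P f g') ->
  dual_cone (fun x => g x - hilbert_m dual_cone g g' * g' x).
Proof.
move=> Vg Vg' A0 Pg'; apply/(dual_coneBr _ _ _ Vg Vg') => f Ff.
have := Pg' _ Ff; rewrite le_eqVlt => /predU1P[P0|P0].
  have [b [_ /(dual_coneBr _ _ _ Vg Vg')/(_ _ Ff)]] := A0.
  by rewrite -P0 !mulr0.
rewrite -ler_pdivlMr//; apply: ge_sup => // b [_].
by move=> /(dual_coneBr _ _ _ Vg Vg')/(_ _ Ff); rewrite ler_pdivlMr.
Qed.

(** Let [i] be [P e g / P e g'], which lies between [m] and [M]. Since M g' - g and g - m g' are in
    the cone, the lower bound in [L_bounds] makes their images dominate l (M - i) L g' and l (i - m)
    L g'. So [M] drops and [m] rises by these amounts, and the gap M - m shrinks by the factor 1 -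
    l. *)
Theorem birkhoff_dual_cone g g' : dual_cone g -> dual_cone g' ->
  (hilbert_dist dual_cone is_zero (L g) (L g') <=
   (1 - (c / C) ^+ 5)%:E * hilbert_dist dual_cone is_zero g g')%E.
Proof.
move=> Gg Gg'.
have [Vg Pg] := Gg; have [Vg' Pg'] := Gg'.
have C0 : 0 < C by move: c_gt0 cC; lra.
set l := c / C.
have l0 : 0 < l by rewrite divr_gt0.
have l2 : l <= 2^-1 by rewrite ler_pdivrMr//; move: cC; lra.
have l5 : l ^+ 5 <= 2^-1.
  have l1 : l <= 1 by lra.
  by rewrite (le_trans _ l2)// exprS ler_piMr ?exprn_ile1//; exact: ltW.
rewrite [in leRHS]/hilbert_dist.
case: asboolP => [[gg' g'0]|_]; last first.
  (* The distance on the right is infinite and its factor is positive. *)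
  by rewrite gt0_muley ?leey// lte_fin; lra.
have I'0 : 0 < P e g' by exact: cone_pos.
have [b [b' [b0 b'0 gb gb']]] := gg'.
(* Nonvanishing is given for [g']; comparability carries positivity over to [g]. *)
have I0 : 0 < P e g.
  move/(dual_coneBl _ _ _ Vg' Vg)/(_ _ e_F) : gb'.
  by move=> /(lt_le_trans I'0); rewrite pmulr_rgt0.
set M := hilbert_M dual_cone g g'.
set m := hilbert_m dual_cone g g'.
have GM : dual_cone (fun x => M * g' x - g x).
  by apply: M_attained => //; exists b.
have gam : [set a : R | 0 < a /\ dual_cone (fun x => g x - a * g' x)] b'^-1.
  split; first by rewrite invr_gt0.
  apply/(dual_coneBr _ _ _ Vg Vg') => f Ff.
  have := (dual_coneBl _ _ _ Vg' Vg).1 gb' _ Ff.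
  by rewrite ler_pdivrMl.
have Gm : dual_cone (fun x => g x - m * g' x).
  by apply: m_attained => //; exists b'^-1.
have m0 : 0 < m.
  apply: (@lt_le_trans _ _ b'^-1); first by rewrite invr_gt0.
  by case: gam => b'0' h; exact: m_ge.
set i := P e g / P e g'.
have i0 : 0 < i by rewrite divr_gt0.
have mi : m <= i.
  by rewrite ler_pdivlMr//; have := (dual_coneBr _ _ _ Vg Vg').1 Gm _ e_F.
have iM : i <= M.
  by rewrite ler_pdivrMr//; have := (dual_coneBl _ _ _ Vg Vg').1 GM _ e_F.
have VLg := L_V _ Vg; have VLg' := L_V _ Vg'.
have IL0 : 0 < P e (L g').
  by apply: lt_le_trans (L_bound_e _ Gg'); rewrite mulr_gt0.
have Ei : P e g = i * P e g' by rewrite /i divfK// gt_eqF.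
have Ec : c = l * C by rewrite /l divfK// gt_eqF.
(* up1 and lo1 bound the projective diameter of the image, which settles the
   case of large M / m; up2 and lo2 improve on M and m and settle M / m near 1. *)
have up1 : dual_cone (fun x => (i / l) * L g' x - L g x).
  apply/(dual_coneBl _ _ _ VLg VLg') => f Ff.
  have [a a0 h] := L_bounds _ Ff.
  have [_ h1] := h _ Gg; have [h2 _] := h _ Gg'.
  rewrite (le_trans h1)// Ei.
  have -> : C * a * (i * P e g') = i / l * (c * a * P e g').
    by rewrite Ec; field; rewrite gt_eqF.
  by rewrite ler_wpM2l// divr_ge0// ltW.
have lo1 : dual_cone (fun x => L g x - (i * l) * L g' x).
  apply/(dual_coneBr _ _ _ VLg VLg') => f Ff.
  have [a a0 h] := L_bounds _ Ff.
  have [h1 _] := h _ Gg; have [_ h2] := h _ Gg'.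
  rewrite (le_trans _ h1)// Ei.
  have -> : c * a * (i * P e g') = i * l * (C * a * P e g').
    by rewrite Ec; ring.
  by rewrite ler_wpM2l// mulr_ge0// ltW.
have up2 : dual_cone (fun x => (M - l * (M - i)) * L g' x - L g x).
  apply/(dual_coneBl _ _ _ VLg VLg') => f Ff.
  have [a a0 h] := L_bounds _ Ff.
  have [h1 _] := h _ GM; have [_ h2] := h _ Gg'.
  move: h1.
  have -> : (fun x => M * g' x - g x) = (fun x => M * g' x + (-1) * g x).
    by apply/funext => x; rewrite mulN1r.
  rewrite L_lin// !P_lin// Ei.
  have -> : c * a * (M * P e g' + -1 * (i * P e g')) =
            l * (M - i) * (C * a * P e g') by rewrite Ec; ring.
  have : l * (M - i) * P f (L g') <= l * (M - i) * (C * a * P e g').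
    by rewrite ler_wpM2l// mulr_ge0// ?(ltW l0)// subr_ge0.
  lra.
have lo2 : dual_cone (fun x => L g x - (m + l * (i - m)) * L g' x).
  apply/(dual_coneBr _ _ _ VLg VLg') => f Ff.
  have [a a0 h] := L_bounds _ Ff.
  have [h1 _] := h _ Gm; have [_ h2] := h _ Gg'.
  move: h1.
  have -> : (fun x => g x - m * g' x) = (fun x => 1 * g x + (- m) * g' x).
    by apply/funext => x; rewrite mul1r mulNr.
  rewrite L_lin// !P_lin// Ei.
  have -> : c * a * (1 * (i * P e g') + - m * P e g') =
            l * (i - m) * (C * a * P e g') by rewrite Ec; ring.
  have : l * (i - m) * P f (L g') <= l * (i - m) * (C * a * P e g').
    by rewrite ler_wpM2l// mulr_ge0// ?(ltW l0)// subr_ge0.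
  lra.
have il0 : 0 < i * l by rewrite mulr_gt0.
have il'0 : 0 < i / l by rewrite divr_gt0.
rewrite /hilbert_dist; case: asboolP => [_|]; last first.
  case; split; last by move=> /(P_zero _ VLg')/eqP; rewrite gt_eqF.
  exists (i / l), (i * l)^-1; split => //; first by rewrite invr_gt0.
  apply/(dual_coneBl _ _ _ VLg' VLg) => f Ff.
  have := (dual_coneBr _ _ _ VLg VLg').1 lo1 _ Ff.
  by rewrite ler_pdivlMl.
rewrite -EFinM lee_fin; apply: ln_contract => //; first exact: le_trans iM.
- have Mi := M_le _ _ _ il'0 up1.
  have mi' := m_ge _ _ _ VLg VLg' IL0 il0 lo1.
  rewrite ler_pdivrMr; last exact: lt_le_trans mi'.
  rewrite (le_trans Mi)//.
  have -> : i / l = l ^- 2 * (i * l) by field; rewrite gt_eqF.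
  by rewrite ler_wpM2l// invr_ge0 exprn_ge0// ltW.
- have b20 : 0 < M - l * (M - i) by nra.
  have a20 : m <= m + l * (i - m) by nra.
  have a20' : 0 < m + l * (i - m) by lra.
  have Mi := M_le _ _ _ b20 up2.
  have mi' := m_ge _ _ _ VLg VLg' IL0 a20' lo2.
  rewrite ler_pdivrMr; last exact: lt_le_trans mi'.
  rewrite (le_trans Mi)//.
  (* The improved upper constant equals the improved lower one plus (1 - l)(M - m); relative to the
     lower one this excess is largest when the latter is replaced by [m]. *)
  apply: (@le_trans _ _ ((1 + (1 - l) * ((M - m) / m)) * (m + l * (i - m)))).
    rewrite mulrDl mul1r.
    have : (1 - l) * ((M - m) / m) * m <= (1 - l) * ((M - m) / m) * (m + l * (i - m)).
      apply: ler_wpM2l => //.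
      by rewrite mulr_ge0 ?divr_ge0//; lra.
    rewrite mulrA divfK ?gt_eqF//; lra.
  apply: ler_wpM2l => //.
  by rewrite addr_ge0// mulr_ge0 ?divr_ge0//; lra.
Qed.

End birkhoff.

(** * Square-integrable functions on a probability space *)

Section L2_probability.
Context {R : realType} {dsp : measure_display} {T : measurableType dsp}.
Variable mu : probability T R.
Implicit Types f g : T -> R.

Lemma bounded_integrable f M : measurable_fun setT f ->
  (forall x, `|f x| <= M) -> mu.-integrable setT (EFin \o f).
Proof.
move=> mf fM; apply: (@le_integrable _ _ _ mu _ measurableT _ (EFin \o cst M)).
- exact/measurable_EFinP.
- by move=> x _ /=; rewrite lee_fin (le_trans (fM x))// ler_norm.
- exact: finite_measure_integrable_cst.
Qed.

Lemma L2_integrable_sqr f : L2 mu f ->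
  mu.-integrable setT (EFin \o (fun x => f x ^+ 2)).
Proof.
move=> [mf f2]; apply/integrableP; split.
  by apply/measurable_EFinP; exact: measurable_funX.
by under eq_integral => x _ do rewrite /= ger0_norm ?sqr_ge0//.
Qed.

Lemma integrable_sqr_L2 f : measurable_fun setT f ->
  mu.-integrable setT (EFin \o (fun x => f x ^+ 2)) -> L2 mu f.
Proof.
move=> mf /integrableP[_ f2]; split => //.
by under eq_integral => x _ do rewrite -(@ger0_norm _ (f x ^+ 2)) ?sqr_ge0//.
Qed.

Lemma bounded_L2 f M : measurable_fun setT f -> (forall x, `|f x| <= M) ->
  L2 mu f.
Proof.
move=> mf fM; apply: integrable_sqr_L2 => //.
apply: (@bounded_integrable _ (M ^+ 2)); first exact: measurable_funX.
move=> x; rewrite normrX lerXn2r// ?nnegrE//.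
exact: le_trans (fM x).
Qed.

Lemma L2_mul_integrable f g : L2 mu f -> L2 mu g ->
  mu.-integrable setT (EFin \o (fun x => f x * g x)).
Proof.
move=> Lf Lg; have [mf _] := Lf; have [mg _] := Lg.
apply: (@le_integrable _ _ _ mu _ measurableT _
    (EFin \o (fun x => f x ^+ 2 + g x ^+ 2))).
- by apply/measurable_EFinP; exact: measurable_funM.
- move=> x _ /=; rewrite lee_fin [leRHS]ger0_norm ?addr_ge0 ?sqr_ge0//.
  rewrite normrM -(real_normK (num_real (f x))) -(real_normK (num_real (g x))).
  have := sqr_ge0 (`|f x| - `|g x|).
  have : 0 <= `|f x| * `|g x| by rewrite mulr_ge0.
  nra.
- have := integrableD measurableT (L2_integrable_sqr _ Lf)
    (L2_integrable_sqr _ Lg).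
  by [].
Qed.

Lemma L2_cst r : L2 mu (fun=> r).
Proof. by apply: (@bounded_L2 _ `|r|). Qed.

Lemma L2_integrable f : L2 mu f -> mu.-integrable setT (EFin \o f).
Proof.
move=> Lf; have := L2_mul_integrable _ _ Lf (L2_cst 1).
by congr integrable; apply/funext => x /=; rewrite mulr1.
Qed.

Lemma L2_lin a b f g : L2 mu f -> L2 mu g ->
  L2 mu (fun x => a * f x + b * g x).
Proof.
move=> Lf Lg; have [mf _] := Lf; have [mg _] := Lg.
apply: integrable_sqr_L2.
  by apply: measurable_funD; exact: measurable_funM.
have -> : EFin \o (fun x => (a * f x + b * g x) ^+ 2) =
   ((fun x => (a ^+ 2)%:E * (f x ^+ 2)%:E) \+
   ((fun x => (a * b *+ 2)%:E * (f x * g x)%:E) \+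
    (fun x => (b ^+ 2)%:E * (g x ^+ 2)%:E)))%E.
  by apply/funext => x /=; rewrite -!EFinM -!EFinD; congr EFin; ring.
apply: integrableD => //; first exact/integrableZl/L2_integrable_sqr.
apply: integrableD => //; first exact/integrableZl/L2_mul_integrable.
exact/integrableZl/L2_integrable_sqr.
Qed.

Lemma integrable_scale a f : mu.-integrable setT (EFin \o f) ->
  mu.-integrable setT (EFin \o (fun x => a * f x)).
Proof. by move=> If; exact: (integrableZl measurableT a If). Qed.

Lemma integrable_lin a b f g : mu.-integrable setT (EFin \o f) ->
  mu.-integrable setT (EFin \o g) ->
  \int[mu]_x (a * f x + b * g x) = a * \int[mu]_x f x + b * \int[mu]_x g x.
Proof.
move=> If Ig; rewrite -!RintegralZl// -RintegralD//.
  exact: integrable_scale.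
exact: integrable_scale.
Qed.

Lemma L2_pairing_lin f a b g g' : L2 mu f -> L2 mu g -> L2 mu g' ->
  \int[mu]_x (f x * (a * g x + b * g' x)) =
  a * \int[mu]_x (f x * g x) + b * \int[mu]_x (f x * g' x).
Proof.
move=> Lf Lg Lg'; rewrite -integrable_lin; try exact: L2_mul_integrable.
by congr Rintegral; apply/funext => x; ring.
Qed.

(** * Integral operators with kernel in (0,1] *)

Section kernel.
Variable K : T -> T -> R.
Hypothesis mK : measurable_fun setT (fun p : T * T => K p.1 p.2).
Hypothesis K01 : forall x y, 0 < K x y <= 1.

Let K_norm x y : `|K x y| <= 1.
Proof. by have /andP[K0 K1] := K01 x y; rewrite gtr0_norm. Qed.

Lemma measurable_section2 x : measurable_fun setT (K x).
Proof. exact: (measurableT_comp mK (pair1_measurable x)). Qed.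

Lemma kernel_mul_integrable f x : mu.-integrable setT (EFin \o f) ->
  mu.-integrable setT (EFin \o (fun y => K x y * f y)).
Proof.
move=> If; apply: (@le_integrable _ _ _ mu _ measurableT _ (EFin \o f)) => //.
  apply/measurable_EFinP; apply: measurable_funM.
    exact: measurable_section2.
  by case/integrableP : If => /measurable_EFinP.
by move=> y _ /=; rewrite lee_fin normrM ler_piMl.
Qed.

(** By Tonelli and |K| <= 1, the double integral of the absolute value is at most the product of the
    two L^1 norms. This licenses Fubini for the adjoint formula and the measurability of [Lop]. *)
Lemma kernel_prod_integrable f g : mu.-integrable setT (EFin \o f) ->
  mu.-integrable setT (EFin \o g) ->
  (mu \x mu)%E.-integrable setT
    (EFin \o (fun p : T * T => f p.1 * (K p.1 p.2 * g p.2))).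
Proof.
move=> If Ig.
have mf : measurable_fun setT f.
  by case/integrableP : If => /measurable_EFinP.
have mg : measurable_fun setT g.
  by case/integrableP : Ig => /measurable_EFinP.
have mfKg : measurable_fun setT
    (EFin \o (fun p : T * T => f p.1 * (K p.1 p.2 * g p.2))).
  apply/measurable_EFinP; apply: measurable_funM.
    exact: measurableT_comp.
  by apply: measurable_funM => //; exact: measurableT_comp.
apply/integrable12ltyP => //.
have Ifn := integrable_norm If; have Ign := integrable_norm Ig.
apply: (@le_lt_trans _ _
    (\int[mu]_x (`|f x|%:E * \int[mu]_y (`|g y|)%:E))%E).
  apply: ge0_le_integral => //.
  - by move=> x _; exact: integral_ge0.
  - have mabs := measurableT_comp (@abse_measurable R setT) mfKg.
    exact: (measurable_fun_fubini_tonelli_F _ mabs (fun=> abse_ge0 _)).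
  - apply: emeasurable_funM => //.
    by case/integrableP : Ifn.
  move=> x _; rewrite -ge0_integralZl//; last first.
    by case/integrableP : Ign.
  apply: ge0_le_integral => //.
  - apply: measurableT_comp => //.
    exact: (measurableT_comp mfKg (pair1_measurable x)).
  - by apply: measurable_funeM; case/integrableP : Ign.
  move=> y _; rewrite /= lee_fin !normrM.
  by rewrite ler_wpM2l// ler_piMl.
have Igfin := integrable_fin_num measurableT Ign.
rewrite -(fineK Igfin) ge0_integralZr//; last 2 first.
  by case/integrableP : Ifn.
  rewrite lee_fin; apply: fine_ge0; apply: integral_ge0 => x _.
  by rewrite lee_fin; exact: normr_ge0.
have Iffin := integrable_fin_num measurableT Ifn.
by rewrite -(fineK Iffin) -EFinM ltry.
Qed.

Lemma LopE g x : Lop mu K g x = \int[mu]_y (K x y * g y).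
Proof. by []. Qed.

Lemma Lop_lin a b g g' : L2 mu g -> L2 mu g' ->
  Lop mu K (fun x => a * g x + b * g' x) =
  (fun x => a * Lop mu K g x + b * Lop mu K g' x).
Proof.
move=> Lg Lg'; apply/funext => x; rewrite !LopE -integrable_lin.
- by congr Rintegral; apply/funext => y; ring.
- exact/kernel_mul_integrable/L2_integrable.
- exact/kernel_mul_integrable/L2_integrable.
Qed.

Lemma measurable_Lop g : mu.-integrable setT (EFin \o g) ->
  measurable_fun setT (Lop mu K g).
Proof.
(* With the constant 1 as first factor, the partial integral of the product is [Lop] itself. *)
move=> Ig; have I1 : mu.-integrable setT (EFin \o (fun=> 1 : R)).
  exact: finite_measure_integrable_cst.
have := measurable_fubini_F (kernel_prod_integrable _ _ I1 Ig).
move=> mF; have := measurableT_comp (@fine_measurable R setT measurableT) mF.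
congr measurable_fun; apply/funext => x /=.
by congr fine; apply: eq_integral => y _ /=; rewrite mul1r.
Qed.

(** As |K| <= 1, the image is bounded by the L^1 norm of [g], and bounded measurable functions are
    square integrable for a probability. *)
Lemma Lop_L2 g : L2 mu g -> L2 mu (Lop mu K g).
Proof.
move=> /L2_integrable Ig.
apply: (@bounded_L2 _ (\int[mu]_y `|g y|)); first exact: measurable_Lop.
move=> x; rewrite LopE.
have IKg := kernel_mul_integrable _ x Ig.
rewrite (le_trans (le_normr_Rintegral _ _))//.
apply: le_Rintegral => //.
- exact: integrable_norm.
- exact: integrable_norm.
- by move=> y _; rewrite normrM ler_piMl.
Qed.

End kernel.

(** Fubini: the adjoint has the transposed kernel. This turns estimates for the operator on the dual
    cone into estimates on test functions. *)
Lemma Lop_adjoint (K : T -> T -> R) f g :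
  measurable_fun setT (fun p : T * T => K p.1 p.2) ->
  (forall x y, 0 < K x y <= 1) -> L2 mu f -> L2 mu g ->
  \int[mu]_x (f x * Lop mu K g x) =
  \int[mu]_y (Lop mu (fun y x => K x y) f y * g y).
Proof.
move=> mK K01 /L2_integrable If /L2_integrable Ig.
have mK' : measurable_fun setT (fun p : T * T => K p.2 p.1).
  exact: (measurableT_comp mK (measurable_fun_pair measurable_snd measurable_fst)).
have := Fubini (kernel_prod_integrable _ mK K01 _ _ If Ig).
have E1 x : (\int[mu]_y (f x * (K x y * g y))%:E =
   (f x * Lop mu K g x)%:E)%E.
  rewrite LopE -RintegralZl//; last exact: kernel_mul_integrable.
  rewrite /Rintegral fineK//; apply: integrable_fin_num => //.
  by apply: integrable_scale; exact: kernel_mul_integrable.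
have E2 y : (\int[mu]_x (f x * (K x y * g y))%:E =
   (Lop mu (fun y x => K x y) f y * g y)%:E)%E.
  have IK := kernel_mul_integrable _ mK' (fun x y => K01 y x) _ y If.
  rewrite LopE -RintegralZr//.
  rewrite /Rintegral fineK//; last first.
    apply: integrable_fin_num => //; have := integrable_scale (g y) _ IK.
    by congr integrable; apply/funext => x /=; rewrite mulrC.
  by apply: eq_integral => x _; congr EFin; ring.
move=> E; congr fine; move: E => /=.
by under eq_integral do rewrite E1; under [RHS]eq_integral do rewrite E2.
Qed.

End L2_probability.

(** * The cone F of test functions for a concentrated measure *)

Section concentrated_cone.
Context {R : realType} {dsp : measure_display} {T : measurableType dsp}.
Variables (mu : probability T R) (dist : T -> T -> R) (x0 : T) (m J : R).

Let B := ball_c dist x0.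

Hypothesis mB : forall r, measurable (B r).

Definition tail_mass r := fine (mu (~` B r)).

(* The exponential only serves to make [alpha_pos] positive when [tail_mass]
   vanishes; the factors 16 and 2 make the two tail conditions of [Fset] hold for
   the functions of [Lop_Fset_lower] and [Lop_Fset_upper]. *)
Definition alpha_pos r := 16 * tail_mass r / J + expR (- r) / 4.

Definition alpha_neg r := 2 * tail_mass r.

Let s := tail_mass.
Let F := Fset mu dist x0 m m alpha_pos alpha_neg.

Let mBC r : measurable (~` B r). Proof. exact: measurableC. Qed.

Lemma tail_mass_ge0 r : 0 <= s r. Proof. exact: fine_ge0. Qed.

Lemma tail_mass_nonincr r t : r <= t -> s t <= s r.
Proof.
move=> rt; rewrite fine_le ?fin_num_measure//.
apply: le_measure; rewrite ?inE//; apply: subsetC => x /= xr.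
exact: le_trans rt.
Qed.

Lemma ball_mass r : fine (mu (B r)) = 1 - s r.
Proof.
rewrite /s /tail_mass probability_setC// fineB ?fin_num_measure//=.
lra.
Qed.

Lemma Rintegral_fin_num D f : measurable D ->
  mu.-integrable setT (EFin \o f) ->
  (\int[mu]_(x in D) (f x)%:E)%E = (\int[mu]_(x in D) f x)%:E.
Proof.
move=> mD If; rewrite /Rintegral fineK//; apply: integrable_fin_num => //.
exact: integrableS If.
Qed.

Lemma Rintegral_setC D f : measurable D ->
  mu.-integrable setT (EFin \o f) ->
  \int[mu]_x f x = \int[mu]_(x in D) f x + \int[mu]_(x in ~` D) f x.
Proof.
move=> mD If; rewrite -Rintegral_setU ?setUv//; first exact: measurableC.
by apply/disj_setPS => x [].
Qed.

Lemma fposE (f : T -> R) : fpos f = (f^\+)%R. Proof. by []. Qed.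

Lemma fnegE (f : T -> R) : fneg f = (f^\-)%R.
Proof. by apply/funext => x; rewrite /fneg /funrneg oppr_min oppr0. Qed.

Lemma fpos_ge0 (f : T -> R) x : 0 <= fpos f x.
Proof. by rewrite /fpos le_max lexx orbT. Qed.

Lemma fneg_ge0 (f : T -> R) x : 0 <= fneg f x.
Proof. by rewrite fnegE /funrneg le_max lexx orbT. Qed.

Lemma fposB (f : T -> R) x : f x = fpos f x - fneg f x.
Proof.
rewrite /fpos /fneg; have [h|h] := leP (f x) 0.
  by rewrite opprK add0r.
by rewrite !oppr0 addr0.
Qed.

Lemma fpos_integrable f : mu.-integrable setT (EFin \o f) ->
  mu.-integrable setT (EFin \o fpos f).
Proof. by move=> If; rewrite fposE; exact: integrable_funrpos. Qed.

Lemma fneg_integrable f : mu.-integrable setT (EFin \o f) ->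
  mu.-integrable setT (EFin \o fneg f).
Proof. by move=> If; rewrite fnegE; exact: integrable_funrneg. Qed.

Lemma Rintegral_le_cst D f p : measurable D ->
  mu.-integrable setT (EFin \o f) -> (forall x, f x <= p) ->
  \int[mu]_(x in D) f x <= p * fine (mu D).
Proof.
move=> mD If fp; rewrite -Rintegral_cst//; apply: le_Rintegral => //.
  exact: integrableS If.
exact: finite_measure_integrable_cst.
Qed.

Lemma Rintegral_ge_cst D f p : measurable D ->
  mu.-integrable setT (EFin \o f) -> (forall x, D x -> p <= f x) ->
  p * fine (mu D) <= \int[mu]_(x in D) f x.
Proof.
move=> mD If fp; rewrite -Rintegral_cst//; apply: le_Rintegral => //.
  exact: finite_measure_integrable_cst.
exact: integrableS If.
Qed.

Lemma Rintegral_ge_cstT f p :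
  mu.-integrable setT (EFin \o f) -> (forall x, p <= f x) ->
  p <= \int[mu]_x f x.
Proof.
move=> If fp; have := Rintegral_ge_cst _ _ _ measurableT If (fun x _ => fp x).
by rewrite probability_setT mulr1.
Qed.

(** Outside B_r the positive and negative parts integrate to at most p s(r) and n s(r). Every
    membership in [F] below is derived from this criterion. *)
Lemma Fset_bounded (u : T -> R) (n p : R) : measurable_fun setT u -> 0 <= n -> 0 <= p ->
  (forall x, - n <= u x <= p) -> (forall x, B m x -> 0 <= u x) ->
  (forall r, m <= r -> p * s r <= alpha_pos r * \int[mu]_x u x) ->
  (forall r, m <= r -> n * s r <= alpha_neg r * \int[mu]_x u x) ->
  F u.
Proof.
move=> mu_ n0 p0 unp u0 hp hn.
have Lu : L2 mu u.
  apply: (@bounded_L2 _ _ _ mu _ (n + p)) => // x.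
  by have := unp x; rewrite ler_norml; lra.
have Iu := L2_integrable mu _ Lu.
split => //; first exact: aeW.
- move=> r mr; rewrite !Rintegral_fin_num//; last exact: fpos_integrable.
  rewrite -EFinM lee_fin (le_trans _ (hp _ mr))//.
  apply: Rintegral_le_cst => //; first exact: fpos_integrable.
  by move=> x; rewrite ge_max p0 andbT; have /andP[] := unp x.
- move=> r mr; rewrite !Rintegral_fin_num//; last exact: fneg_integrable.
  rewrite -EFinM lee_fin (le_trans _ (hn _ mr))//.
  apply: Rintegral_le_cst => //; first exact: fneg_integrable.
  by move=> x; rewrite lerNl le_min oppr_le0 n0 andbT; have /andP[] := unp x.
Qed.

Hypothesis m_gt0 : 0 < m.
Hypothesis J01 : 0 < J <= 1.
Hypothesis sm : s m <= J / 64.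

Let J0 : 0 < J. Proof. by case/andP: J01. Qed.
Let J1 : J <= 1. Proof. by case/andP: J01. Qed.

Lemma alpha_pos_gt0 r : 0 < alpha_pos r.
Proof.
rewrite ltr_wpDl ?divr_gt0 ?expR_gt0//.
by rewrite divr_ge0 ?mulr_ge0 ?tail_mass_ge0// ltW.
Qed.

Lemma alpha_pos_ge r : 16 * s r <= alpha_pos r * J.
Proof.
have -> : alpha_pos r * J = 16 * s r + expR (- r) / 4 * J.
  by rewrite /alpha_pos -/s; field; rewrite gt_eqF.
rewrite lerDl mulr_ge0 ?(ltW J0)// divr_ge0// expR_ge0//.
Qed.

(** Each summand is at most 1/4, the first by [sm] and the second by m > 0. *)
Lemma alpha_pos_m : alpha_pos m <= 2^-1.
Proof.
have : 16 * s m / J <= 4^-1 by rewrite ler_pdivrMr//; move: sm; lra.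
have : expR (- m) <= 1 by rewrite -expR0 ler_expR oppr_le0 ltW.
rewrite /alpha_pos -/s; lra.
Qed.

(** The integral is at least 1 and 3 s(r) <= 16 s(r) <= alpha(r) J <= alpha(r). Thus [F] contains a
    sup-norm ball around the constant 2, enough test functions to detect nonzero elements of the
    dual cone. *)
Lemma Fset_one_plus (u : T -> R) : measurable_fun setT u -> (forall x, 1 <= u x <= 3) ->
  F u.
Proof.
move=> mu_ u13.
have Iu : mu.-integrable setT (EFin \o u).
  apply: (@bounded_integrable _ _ _ mu _ 3) => // x.
  by rewrite ger0_norm; have := u13 x; lra.
have u1 : 1 <= \int[mu]_x u x.
  by apply: Rintegral_ge_cstT => // x; have := u13 x; lra.
apply: (Fset_bounded _ 0 3) => //.
- by move=> x; have := u13 x; lra.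
- by move=> x _; have := u13 x; lra.
- move=> r _; have := alpha_pos_ge r; have := tail_mass_ge0 r.
  have := alpha_pos_gt0 r => a0 s0 aJ.
  apply: (@le_trans _ _ (alpha_pos r)); last by rewrite ler_peMr// ltW.
  have : alpha_pos r * J <= alpha_pos r by rewrite ler_piMr// ltW.
  by move: s0; rewrite -/s; lra.
- move=> r _; rewrite mul0r mulr_ge0 ?mulr_ge0 ?tail_mass_ge0//; lra.
Qed.

(** * Mass estimates in F and images under the kernel operator *)

Section Fset_integrals.
Variable f : T -> R.
Hypothesis Ff : F f.
Let a := \int[mu]_x f x.

Let If : mu.-integrable setT (EFin \o f).
Proof. by case: Ff => /(L2_integrable mu). Qed.

Let Ifp := fpos_integrable f If.
Let Ifn := fneg_integrable f If.

Let tailp : \int[mu]_(x in ~` B m) fpos f x <= alpha_pos m * a.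
Proof.
by case: Ff => _ _ /(_ m (lexx _)) + _; rewrite !Rintegral_fin_num.
Qed.

Let tailn : \int[mu]_(x in ~` B m) fneg f x <= alpha_neg m * a.
Proof.
by case: Ff => _ _ _ /(_ m (lexx _)); rewrite !Rintegral_fin_num.
Qed.

Let balln : \int[mu]_(x in B m) fneg f x = 0.
Proof.
have [_ fB _ _] := Ff.
have mfn : measurable_fun setT (EFin \o fneg f) by case/integrableP : Ifn.
rewrite /Rintegral (ae_eq_integral (cst 0%E)) ?integral0//.
  exact: measurable_funTS.
apply: filterS fB => x fB0 Bx; congr EFin.
by rewrite /fneg min_r ?oppr0//; exact: fB0.
Qed.

(** The tail condition at radius [m] bounds a nonnegative integral by alpha(m) a, and alpha(m) >
    0. *)
Lemma Fset_integral_ge0 : 0 <= a.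
Proof.
rewrite -(pmulr_rge0 _ (alpha_pos_gt0 m)) (le_trans _ tailp)//.
by apply: Rintegral_ge0 => x _; exact: fpos_ge0.
Qed.

Lemma Fset_integral_neg : \int[mu]_x fneg f x <= J / 32 * a.
Proof.
rewrite (Rintegral_setC _ _ (mB m))// balln add0r (le_trans tailn)//.
rewrite ler_wpM2r ?Fset_integral_ge0//; move: sm; rewrite /alpha_neg -/s; lra.
Qed.

Lemma Fset_integral_pos :
  \int[mu]_x fpos f x = a + \int[mu]_x fneg f x.
Proof.
rewrite /a (_ : \int[mu]_x f x = \int[mu]_x (fpos f x - fneg f x)).
  by rewrite RintegralB//; lra.
by congr Rintegral; apply/funext => x; exact: fposB.
Qed.

(** The positive part has total mass at least [a], of which at most half lies outside the ball. *)
Lemma Fset_integral_pos_ball : a / 2 <= \int[mu]_(x in B m) fpos f x.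
Proof.
have := Rintegral_setC _ _ (mB m) Ifp; rewrite Fset_integral_pos.
have : 0 <= \int[mu]_x fneg f x.
  by apply: Rintegral_ge0 => x _; exact: fneg_ge0.
have : alpha_pos m * a <= 2^-1 * a.
  by rewrite ler_wpM2r ?Fset_integral_ge0// alpha_pos_m.
by move: tailp; lra.
Qed.

Variable K : T -> T -> R.
Hypothesis mK : measurable_fun setT (fun p : T * T => K p.1 p.2).
Hypothesis K01 : forall x y, 0 < K x y <= 1.
Hypothesis KJ : forall x y, B m x -> B m y -> J <= K x y.

(** In the application [K] is the transposed kernel, so [h] is the image of [f] under the
    adjoint. *)
Let h := Lop mu K f.

Let hE y : h y = \int[mu]_x (K y x * fpos f x) - \int[mu]_x (K y x * fneg f x).
Proof.
rewrite -RintegralB//; try exact: kernel_mul_integrable.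
by congr Rintegral; apply/funext => x; rewrite -mulrBr -fposB.
Qed.

Let Kf_bounds (u : T -> R) y : mu.-integrable setT (EFin \o u) ->
  (forall x, 0 <= u x) ->
  0 <= \int[mu]_x (K y x * u x) <= \int[mu]_x u x.
Proof.
move=> Iu u0; apply/andP; split.
  apply: Rintegral_ge0 => x _; rewrite mulr_ge0//.
  by have /andP[/ltW] := K01 y x.
apply: le_Rintegral => //; first exact: kernel_mul_integrable.
by move=> x _; rewrite ler_piMl//; have /andP[] := K01 y x.
Qed.

Lemma Lop_Fset_bounds y : - (J / 8 * a) <= h y <= 9 / 8 * a.
Proof.
have := Kf_bounds _ y Ifp (fpos_ge0 f); have := Kf_bounds _ y Ifn (fneg_ge0 f).
rewrite hE Fset_integral_pos; have := Fset_integral_neg.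
have := Fset_integral_ge0.
have : J * a <= a by rewrite ler_piMl ?Fset_integral_ge0.
have : 0 <= J * a by rewrite mulr_ge0 ?Fset_integral_ge0// ltW.
lra.
Qed.

(** The positive part inside the ball contributes at least J a / 2, the negative part removes at
    most J a / 32. *)
Lemma Lop_Fset_ball y : B m y -> 3 * J / 8 * a <= h y.
Proof.
move=> By.
have := Kf_bounds _ y Ifn (fneg_ge0 f); have := Fset_integral_neg.
have IKp := kernel_mul_integrable mu K mK K01 _ y Ifp.
have : J * (a / 2) <= \int[mu]_x (K y x * fpos f x).
  apply: (@le_trans _ _ (J * \int[mu]_(x in B m) fpos f x)).
    by rewrite ler_wpM2l ?(ltW J0)// Fset_integral_pos_ball.
  rewrite -RintegralZl//; last exact: integrableS Ifp.
  apply: (@le_trans _ _ (\int[mu]_(x in B m) (K y x * fpos f x))).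
    apply: le_Rintegral => //.
    - by apply: integrableS (integrable_scale mu J _ Ifp).
    - exact: integrableS IKp.
    - by move=> x Bx; rewrite ler_wpM2r ?fpos_ge0// KJ.
  rewrite (Rintegral_setC _ _ (mB m))// lerDl; apply: Rintegral_ge0 => x _.
  by rewrite mulr_ge0 ?fpos_ge0//; have /andP[/ltW] := K01 y x.
have : 0 <= J * a by rewrite mulr_ge0 ?Fset_integral_ge0// ltW.
rewrite hE; lra.
Qed.

Let Lh : L2 mu h.
Proof. by apply: Lop_L2 => //; case: Ff. Qed.

Let Ih := L2_integrable mu _ Lh.

Let Lh_integral : J / 4 * a <= \int[mu]_x h x.
Proof.
rewrite (Rintegral_setC _ _ (mB m) Ih).
have := Rintegral_ge_cst _ _ _ (mB m) Ih Lop_Fset_ball.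
have hl x : (~` B m) x -> - (J / 8 * a) <= h x.
  by move=> _; have /andP[] := Lop_Fset_bounds x.
have := Rintegral_ge_cst _ _ _ (mBC m) Ih hl.
rewrite ball_mass -/(tail_mass m) -/s.
have Ja : 0 <= J * a by rewrite mulr_ge0 ?Fset_integral_ge0// ltW.
have : J * a * s m <= J * a * 64^-1.
  by apply: ler_wpM2l => //; move: sm J1; lra.
lra.
Qed.

(** The difference lies between - J a / 4 and 9 a / 8, is nonnegative on the ball and has integral
    at least J a / 8. The negative tail condition then uses the factor 2 of [alpha_neg] exactly: J a
    / 4 = 2 (J a / 8). *)
Lemma Lop_Fset_lower : F (fun x => h x - J / 8 * a).
Proof.
have a0 := Fset_integral_ge0.
have Ja : 0 <= J * a by rewrite mulr_ge0// ltW.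
have Ja1 : J * a <= a by rewrite ler_piMl.
have hb := Lop_Fset_bounds.
have hi : J / 8 * a <= \int[mu]_x (h x - J / 8 * a).
  rewrite RintegralB//; last exact: finite_measure_integrable_cst.
  rewrite Rintegral_cst//.
  have -> : fine (mu setT) = 1 by rewrite probability_setT.
  rewrite mulr1.
  by move: Lh_integral; lra.
apply: (Fset_bounded _ (J / 4 * a) (9 / 8 * a)).
- by apply: measurable_funB => //; case: Lh.
- lra.
- lra.
- by move=> x; have := hb x; lra.
- by move=> x /Lop_Fset_ball; lra.
- move=> r _; apply: (@le_trans _ _ (alpha_pos r * (J / 8 * a))); last first.
    by rewrite ler_wpM2l// ltW// alpha_pos_gt0.
  have : 16 * s r * a <= alpha_pos r * J * a.
    by rewrite ler_wpM2r// alpha_pos_ge.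
  have : 0 <= s r * a by rewrite mulr_ge0// tail_mass_ge0.
  lra.
- move=> r _; apply: (@le_trans _ _ (alpha_neg r * (J / 8 * a))).
    rewrite /alpha_neg -/s; lra.
  by rewrite ler_wpM2l// mulr_ge0// tail_mass_ge0.
Qed.

(** Here the values lie between 0 and 5 a and the integral is at least 2 a, so only the positive
    tail has to be controlled. *)
Lemma Lop_Fset_upper : F (fun x => 4 * a - h x).
Proof.
have a0 := Fset_integral_ge0.
have Ja : 0 <= J * a by rewrite mulr_ge0// ltW.
have Ja1 : J * a <= a by rewrite ler_piMl.
have hb := Lop_Fset_bounds.
have Ihu : mu.-integrable setT (EFin \o (fun x => 4 * a - h x)).
  have Ic : mu.-integrable setT (EFin \o (fun=> 4 * a)).
    exact: finite_measure_integrable_cst.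
  exact: (integrableB measurableT Ic Ih).
have hi : 2 * a <= \int[mu]_x (4 * a - h x).
  by apply: Rintegral_ge_cstT => // x; have := hb x; lra.
apply: (Fset_bounded _ 0 (5 * a)) => //.
- by apply: measurable_funB => //; case: Lh.
- lra.
- by move=> x; have := hb x; lra.
- by move=> x _; have := hb x; lra.
- move=> r _; apply: (@le_trans _ _ (alpha_pos r * (2 * a))); last first.
    by rewrite ler_wpM2l// ltW// alpha_pos_gt0.
  have : 16 * s r * a <= alpha_pos r * J * a.
    by rewrite ler_wpM2r// alpha_pos_ge.
  have : 0 <= s r * a by rewrite mulr_ge0// tail_mass_ge0.
  have : alpha_pos r * (J * a) <= alpha_pos r * a.
    by rewrite ler_wpM2l// ltW// alpha_pos_gt0.
  lra.
- move=> r _; rewrite mul0r mulr_ge0//; last lra.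
  by rewrite mulr_ge0// tail_mass_ge0.
Qed.

End Fset_integrals.

End concentrated_cone.

(** * Contraction of Hilbert's metric on the dual cone G *)

Section concentrated_contraction.
Context {R : realType} {dsp : measure_display} {T : measurableType dsp}.
Variables (mu : probability T R) (dist : T -> T -> R) (x0 : T) (m J : R).

Let B := ball_c dist x0.
Let F := Fset mu dist x0 m m (alpha_pos mu dist x0 J) (alpha_neg mu dist x0).
Let G := Gcone mu dist x0 m m (alpha_pos mu dist x0 J) (alpha_neg mu dist x0).
Let P (f g : T -> R) := \int[mu]_x (f x * g x).

(** Products of square-integrable functions are integrable, so the extended-real pairing is finite
    and agrees with the real one. *)
Lemma Gcone_dual_cone : G = dual_cone (L2 mu) F P.
Proof.
have E f g : L2 mu f -> L2 mu g ->
    (0 <= \int[mu]_x (f x * g x)%:E)%E = (0 <= P f g).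
  move=> Lf Lg; rewrite Rintegral_fin_num ?lee_fin//.
  exact: L2_mul_integrable.
apply/seteqP; split => g [Lg h]; split => // f Ff; have [Lf _ _ _] := Ff.
  by rewrite -E//; exact: h.
by rewrite E//; exact: h.
Qed.

Lemma pairing_subr (h g : T -> R) b : L2 mu h -> L2 mu g ->
  P (fun x => h x - b) g = P h g - b * P (fun=> 1) g.
Proof.
move=> Lh Lg; rewrite -mulNr -(mul1r (P h g)) /P -integrable_lin.
- by congr Rintegral; apply/funext => x; ring.
- exact: L2_mul_integrable.
- by apply: L2_mul_integrable => //; exact: L2_cst.
Qed.

Lemma pairing_subl (h g : T -> R) b : L2 mu h -> L2 mu g ->
  P (fun x => b - h x) g = b * P (fun=> 1) g - P h g.
Proof.
move=> Lh Lg; rewrite -[X in _ - X]mul1r -mulNr /P -integrable_lin.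
- by congr Rintegral; apply/funext => x; ring.
- by apply: L2_mul_integrable => //; exact: L2_cst.
- exact: L2_mul_integrable.
Qed.

Hypothesis mB : forall r, measurable (B r).
Hypothesis m_gt0 : 0 < m.
Hypothesis J01 : 0 < J <= 1.
Hypothesis sm : tail_mass mu dist x0 m <= J / 64.

(** Truncate [g] to [-1,1] to get [phi]. Then 2 - phi is in [F], so the integral of phi g is at most
    twice that of [g]. Since phi g >= 0, a nonpositive integral of [g] forces phi g = 0, that is g =
    0, almost everywhere. *)
Lemma dual_cone_integral_gt0 g : dual_cone (L2 mu) F P g ->
  ~ ae_zero mu g -> 0 < P (fun=> 1) g.
Proof.
move=> [Lg Pg] g0; rewrite ltNge; apply/negP => Pg0; apply: g0.
pose phi x := Num.max (Num.min (g x) 1) (-1).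
have mg : measurable_fun setT g by case: Lg.
have mphi : measurable_fun setT phi.
  by apply: measurable_maxr => //; exact: measurable_minr.
have phi1 x : -1 <= phi x <= 1.
  by rewrite /phi /Num.max /Num.min; do 2 case: ifPn; rewrite -?leNgt; lra.
have Lphi : L2 mu phi.
  by apply: (@bounded_L2 _ _ _ mu _ 1) => // x; rewrite ler_norml.
have phig x : 0 <= phi x * g x.
  by rewrite /phi /Num.max /Num.min; do 2 case: ifPn; rewrite -?leNgt; nra.
have F2 : F (fun x => 2 - phi x).
  apply: Fset_one_plus => //; first exact: measurable_funB.
  by move=> x; have := phi1 x; lra.
have Iphig := L2_mul_integrable mu _ _ Lphi Lg.
have Pphi : P phi g = 0.
  have := Pg _ F2; rewrite pairing_subl// => P2.
  have : 0 <= P phi g by exact: Rintegral_ge0.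
  by move: Pg0; lra.
have : (\int[mu]_x `|(phi x * g x)%:E| = 0)%E.
  under eq_integral => x _ do rewrite /= ger0_norm//.
  by rewrite Rintegral_fin_num// -/(P phi g) Pphi.
move=> /ae_eq_integral_abs; case/integrableP : Iphig => mphig _.
move=> /(_ measurableT mphig); apply: filterS => x /(_ I) [].
by rewrite /phi /Num.max /Num.min; do 2 case: ifPn; rewrite -?leNgt; nra.
Qed.

Variable K : T -> T -> R.
Hypothesis mK : measurable_fun setT (fun p : T * T => K p.1 p.2).
Hypothesis K01 : forall x y, 0 < K x y <= 1.
Hypothesis KJ : forall x y, B m x -> B m y -> J <= K x y.

Let Fone : F (fun=> 1).
Proof. by apply: Fset_one_plus => // x; lra. Qed.

(** After passing to the adjoint, [g] is paired with the two elements of [F] from [Lop_Fset_lower]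
    and [Lop_Fset_upper]; nonnegativity of these pairings is the claim. *)
Let Lop_pairing_bounds f g : F f -> dual_cone (L2 mu) F P g ->
  J / 8 * \int[mu]_x f x * P (fun=> 1) g <= P f (Lop mu K g) /\
  P f (Lop mu K g) <= 4 * \int[mu]_x f x * P (fun=> 1) g.
Proof.
move=> Ff [Lg Pg]; have [Lf _ _ _] := Ff.
have mK' : measurable_fun setT (fun p : T * T => K p.2 p.1).
  exact: (measurableT_comp mK (measurable_fun_pair measurable_snd measurable_fst)).
have KJ' x y : B m x -> B m y -> J <= K y x by move=> Bx By; exact: KJ.
have K01' x y : 0 < K y x <= 1 by exact: K01.
have Lh : L2 mu (Lop mu (fun y x => K x y) f) by exact: Lop_L2.
rewrite /P Lop_adjoint//.
have Fl : F (fun x => Lop mu (fun y x => K x y) f x - J / 8 * \int[mu]_x f x).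
  exact: Lop_Fset_lower.
have Fu : F (fun x => 4 * \int[mu]_x f x - Lop mu (fun y x => K x y) f x).
  exact: Lop_Fset_upper.
have := Pg _ Fl; have := Pg _ Fu.
rewrite pairing_subl// pairing_subr// !subr_ge0.
by split.
Qed.

(** Birkhoff's principle with e = 1, c = J / 8, C = 4, the scale of [f] being its integral; that of
    [e] is 1. *)
Theorem Lop_contraction g g' : G g -> G g' ->
  (hilbert_dist G (ae_zero mu) (Lop mu K g) (Lop mu K g') <=
   (1 - (J / 8 / 4) ^+ 5)%:E * hilbert_dist G (ae_zero mu) g g')%E.
Proof.
have /andP[J0 J1] := J01.
rewrite Gcone_dual_cone.
apply: (birkhoff_dual_cone (L2 mu) F P (Lop mu K) (fun=> 1)) => //.
- by move=> *; exact: L2_lin.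
- by move=> f a b u v [Lf _ _ _] Lu Lv; exact: L2_pairing_lin.
- by move=> u; exact: Lop_L2.
- by move=> a b u v Lu Lv; exact: Lop_lin.
- move=> u [mu_ _] u0; rewrite /P /Rintegral (ae_eq_integral (cst 0%E)) ?integral0//.
    by apply/measurable_EFinP; exact: measurable_funM.
  by apply: filterS u0 => x ux _ /=; rewrite ux mulr0.
- exact: dual_cone_integral_gt0.
- by rewrite divr_gt0.
- by lra.
- move=> f Ff; exists (\int[mu]_x f x); first exact: (Fset_integral_ge0 mu dist x0 m J).
  by move=> u; exact: Lop_pairing_bounds.
- move=> u /(Lop_pairing_bounds _ _ Fone)[+ _].
  by rewrite Rintegral_cst// mul1r (_ : fine (mu setT) = 1) ?mulr1// probability_setT.
Qed.

End concentrated_contraction.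

(** * Borel balls, choice of the radius and conclusion *)

Lemma polish_ball_measurable (R : realType) (dsp : measure_display)
    (T : measurableType dsp) (dist : T -> T -> R) (x0 : T) (r : R) :
  polish_borel dist -> measurable (ball_c dist x0 r).
Proof.
move=> [[_ [_ [dC dT]]] _ _ mE].
rewrite -[X in measurable X]setCK; apply: measurableC; rewrite mE.
apply: sub_gen_smallest => x /= /negP; rewrite -ltNge => rx.
exists (dist x0 x - r) => [|y xy]; first by rewrite subr_gt0.
by apply/negP; rewrite -ltNge; have := dT x0 y x; rewrite (dC y x); lra.
Qed.

Theorem theorem1p1 (R : realType) (dsp : measure_display) (T : measurableType dsp)
    (dist : T -> T -> R) (x0 : T) (mu : probability T R) (K : T -> T -> R) :
  polish_borel dist ->
  measurable_fun setT (fun p : T * T => K p.1 p.2) ->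
  (forall x y, 0 < K x y <= 1) ->
  (* the ratio mu(X \ B_r) / inf_{x,y in B_r} K^2(x,y) is eventually well
     defined (positive denominator) and tends to 0 as r -> +oo *)
  (\forall r \near +oo,
     0 < inf [set K x y ^+ 2 | x in ball_c dist x0 r & y in ball_c dist x0 r]) ->
  (fine (mu (~` ball_c dist x0 r))
     / inf [set K x y ^+ 2 | x in ball_c dist x0 r & y in ball_c dist x0 r])
     @[r --> +oo] --> (0 : R) ->
  exists (m1 m2 : R) (alpha alpha' : R -> R) (kappa : R),
    [/\ 0 < m1, m1 <= m2, tail_function alpha & tail_function alpha'] /\
    [/\ (0 < mu (ball_c dist x0 m1))%E,
        (forall r, 0 < r -> 0 < alpha r),
        (0 < kappa < 1) &
        forall g g' : T -> R,
          Gcone mu dist x0 m1 m2 alpha alpha' g ->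
          Gcone mu dist x0 m1 m2 alpha alpha' g' ->
          (hilbert_dist (Gcone mu dist x0 m1 m2 alpha alpha') (ae_zero mu)
             (Lop mu K g) (Lop mu K g')
           <= kappa%:E * hilbert_dist (Gcone mu dist x0 m1 m2 alpha alpha')
                           (ae_zero mu) g g')%E ].
Proof.
move=> pb mK K01 infK_gt0 ratio0.
set infK := fun r : R =>
  inf [set K x y ^+ 2 | x in ball_c dist x0 r & y in ball_c dist x0 r].
have mB r : measurable (ball_c dist x0 r) by exact: polish_ball_measurable.
(* K^2 <= K because K takes values in (0,1], so the infimum of K^2 also bounds [K] from below. *)
have infK_le r x y : ball_c dist x0 r x -> ball_c dist x0 r y -> infK r <= K x y.
  move=> Bx By; have /andP[K0 K1] := K01 x y.
  apply: (@le_trans _ _ (K x y ^+ 2)).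
    apply: ge_inf; last by exists x => //; exists y.
    by exists 0 => _ [u _ [v _ <-]]; exact: sqr_ge0.
  by rewrite expr2 ler_piMl// ltW.
have infK_le1 r : 0 < r -> infK r <= 1.
  move=> r0; have Bx0 : ball_c dist x0 r x0.
    by case: pb => -[_ [d0 _]] _ _ _; rewrite /ball_c /= (d0 x0 x0).2// ltW.
  by rewrite (le_trans (infK_le r _ _ Bx0 Bx0))//; have /andP[] := K01 x0 x0.
(* As [infK] is at most 1, the tail mass is dominated by the ratio; its limit makes both tail
   functions vanish at infinity. *)
have s0 : tail_mass mu dist x0 r @[r --> +oo] --> (0 : R).
  apply: (squeeze_cvgr _ (cvg_cst 0) ratio0); near=> r.
  rewrite tail_mass_ge0 ler_pdivlMr//; last by near: r.
  rewrite ler_piMr ?tail_mass_ge0//; apply: infK_le1.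
  by near: r; exact: nbhs_pinfty_gt.
(* The limit is used at one radius only: any [m] with ratio below 1/64 serves as both [m1] and
   [m2]. *)
have : \forall r \near +oo, [/\ 0 < r, 0 < infK r &
    tail_mass mu dist x0 r / infK r < 64^-1].
  near=> r; split; near: r.
  - exact: nbhs_pinfty_gt.
  - exact: infK_gt0.
  - by apply: (cvgr_lt 0 ratio0); lra.
move=> /filter_ex[m [m0 J0 smJ]].
set J := infK m in J0 smJ *.
have J1 : J <= 1 by exact: infK_le1.
have J01 : 0 < J <= 1 by rewrite J0.
have sm : tail_mass mu dist x0 m <= J / 64.
  by move: smJ; rewrite ltr_pdivrMr// => /ltW; lra.
exists m, m, (alpha_pos mu dist x0 J), (alpha_neg mu dist x0),
  (1 - (J / 8 / 4) ^+ 5).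
split; split => //.
- split.
  + move=> r t r0 rt; rewrite lerD//; last first.
      by rewrite ler_wpM2r// ler_expR lerN2.
    by rewrite ler_wpM2r ?invr_ge0 ?(ltW J0)// ler_wpM2l// tail_mass_nonincr.
  + by move=> r _; apply/ltW/alpha_pos_gt0.
  + have -> : (0 : R) = 16 * 0 / J + 0 / 4 by rewrite mulr0 !mul0r addr0.
    apply: cvgD; apply: cvgMl; last exact: cvgr_expR.
    exact: cvgMr.
- split.
  + by move=> r t r0 rt; rewrite ler_wpM2l// tail_mass_nonincr.
  + by move=> r _; rewrite mulr_ge0// tail_mass_ge0.
  + by rewrite -(mulr0 2); exact: cvgMr.
(* A null ball would have tail mass 1, above J / 64. *)
- rewrite lt0e measure_ge0 andbT; apply/eqP => mu0.
  have := ball_mass mu dist x0 mB m; rewrite mu0 /=; lra.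
- by move=> r _; exact: alpha_pos_gt0.
- have J32 : 0 < J / 8 / 4 by rewrite !divr_gt0.
  have J32' : J / 8 / 4 < 1 by lra.
  have : 0 < (J / 8 / 4) ^+ 5 by exact: exprn_gt0.
  have : (J / 8 / 4) ^+ 5 < 1 by rewrite exprn_ilt1// ltW.
  lra.
- move=> g g' Gg Gg'; apply: Lop_contraction => // x y.
  exact: infK_le.
Unshelve. all: by end_near.
Qed.
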